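(* Every hyperpath is $\mathbb{Z}_2\times\mathbb{Z}_2$-cordial.
   Context: A path hypergraph with edges $e_1,\dots,e_m$ ($m\ge 1$, in this order) is a finite hypergraph $H=(V,E)$ with $E=\{e_1,\dots,e_m\}$, $V=e_1\cup\cdots\cup e_m$, $|e_i\cap e_{i+1}|=1$ for $1\le i<m$, and $e_i\cap e_j=\emptyset$ whenever $|i-j|\ge 2$. A hyperpath is a path hypergraph in which every edge has at least 3 vertices. Let $A=\mathbb{Z}_2\times\mathbb{Z}_2$. For a labeling $c:V\to A$, write $v_c(a)=|c^{-1}(a)|$; $c$ is $A$-friendly if $|v_c(a)-v_c(b)|\le 1$ for all $a,b\in A$. It induces $c^*:E\to A$, $c^*(e)=\sum_{v\in e}c(v)$; write $e_{c^*}(a)=|(c^* )^{-1}(a)|$. $H$ is $A$-cordial if it admits an $A$-friendly labeling $c$ with $|e_{c^*}(a)-e_{c^*}(b)|\le 1$ for all $a,b\in A$. *)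

(* Defs.v *)
From HB Require Import structures.
From mathcomp Require Import all_boot all_order all_algebra.
Set Implicit Arguments. Unset Strict Implicit. Unset Printing Implicit Defensive.
Import GRing.Theory.

Notation Agrp := ('Z_2 * 'Z_2)%type.

(* A hypergraph on the finite vertex type T given by an indexed family of
   edges e : 'I_m -> {set T}; its edge set is E = {e_1,...,e_m}. *)
Definition edge_set (T : finType) (m : nat) (e : 'I_m -> {set T}) : {set {set T}} :=
  [set e i | i : 'I_m].

(* Path hypergraph with edges e_1,...,e_m in this order, vertex set V = T
   (every vertex lies in some edge). Indices are 0-based here. *)
Definition path_hypergraph (T : finType) (m : nat) (e : 'I_m -> {set T}) : Prop :=
  [/\ 1 <= m,
      \bigcup_(i < m) e i = [set: T],
      (forall i j : 'I_m, val j = (val i).+1 -> #|e i :&: e j| = 1) &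
      (forall i j : 'I_m, (val i).+2 <= val j -> e i :&: e j = set0)].

Definition hyperpath (T : finType) (m : nat) (e : 'I_m -> {set T}) : Prop :=
  path_hypergraph e /\ (forall i : 'I_m, 3 <= #|e i|).

Definition vcount (T : finType) (c : T -> Agrp) (a : Agrp) : nat :=
  #|[set v : T | c v == a]|.

Definition A_friendly (T : finType) (c : T -> Agrp) : Prop :=
  forall a b : Agrp, vcount c a <= vcount c b + 1.

Definition induced (T : finType) (c : T -> Agrp) (f : {set T}) : Agrp :=
  (\sum_(v in f) c v)%R.

Definition ecount (T : finType) (E : {set {set T}}) (c : T -> Agrp) (a : Agrp) : nat :=
  #|[set f in E | induced c f == a]|.

Definition A_cordial (T : finType) (E : {set {set T}}) : Prop :=
  exists c : T -> Agrp, A_friendly c /\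
    (forall a b : Agrp, ecount E c a <= ecount E c b + 1).

(* Main.v *)
Require Import Defs.
From mathcomp Require Import all_boot all_order all_algebra.
Set Implicit Arguments. Unset Strict Implicit. Unset Printing Implicit Defensive.

(** Order the vertices edge by edge, so that each edge adds [k >= 2] new vertices
    to the joint it shares with its predecessor, one of the new vertices being the
    next joint. Call a labelling of a prefix balanced if its vertex counts and its edge
    counts are; how it can be continued depends only on its state: the labels used once
    more than the minimum, the edge labels used once more than the minimum, and the
    label of the last joint. Four new vertices carrying all four labels do not change
    the state, so only [k = 2, 3, 4, 5] matter. From every state, an edge-by-edge
    extension that ignores the later sizes gets stuck for some sizes, so one follows a
    set of simultaneously reachable states instead: there is a finite family of
    nonempty sets of states such that, for each member [X] and each [k], every state of
    some member is reachable from [X]. Hence no choice of edge sizes gets stuck. *)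

(** * Balanced words and their excess *)

Notation label := (bool * bool)%type.

Definition labels : seq label :=
  [:: (false, false); (false, true); (true, false); (true, true)].

Notation zero_label := (false, false).

Definition add_label (a b : label) : label := (a.1 (+) b.1, a.2 (+) b.2).

Definition sum_label (l : seq label) : label := foldr add_label zero_label l.

Definition tally (s : seq label) : seq nat := [seq count_mem a s | a <- labels].

Definition balanced (s : seq label) : bool :=
  let c := tally s in all (fun x => all (fun y => x <= y.+1) c) c.

Definition excess (s : seq label) : seq label :=
  let c := tally s in [seq a <- labels | has (ltn^~ (count_mem a s)) c].

Lemma mem_labels (a : label) : a \in labels.
Proof. by case: a => [[] []]. Qed.

Lemma balancedP (s : seq label) :
  reflect (forall a b, count_mem a s <= (count_mem b s).+1) (balanced s).
Proof.
apply: (iffP allP) => [bal a b | bal _ /mapP[a _ ->]].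
  have /bal/allP/(_ (count_mem b s)) : count_mem a s \in tally s.
    exact: map_f (mem_labels a).
  by apply; apply: map_f (mem_labels b).
by apply/allP => _ /mapP[b _ ->]; apply: bal.
Qed.

Lemma mem_excess (a : label) (s : seq label) :
  reflect (exists b, count_mem b s < count_mem a s) (a \in excess s).
Proof.
rewrite mem_filter mem_labels andbT.
apply: (iffP hasP) => [[_ /mapP[b _ ->] lt_ba] | [b lt_ba]].
  by exists b.
by exists (count_mem b s); first exact: map_f (mem_labels b).
Qed.

(** Both notions compare counts with one another only, so a uniform shift of all counts is invisible
    to them. *)
Lemma eq_balanced_excess (q : nat) (s t : seq label) :
    (forall a, count_mem a s = q + count_mem a t) ->
  balanced s = balanced t /\ excess s = excess t.
Proof.
move=> count_st; split.
  apply/balancedP/balancedP => bal a b;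
    by have := bal a b; rewrite !count_st -addnS leq_add2l.
apply: eq_in_filter => a _.
have -> : tally s = [seq q + n | n <- tally t].
  by rewrite -map_comp; apply: eq_map => b /=; rewrite count_st.
by rewrite has_map; apply: eq_has => n /=; rewrite count_st ltn_add2l.
Qed.

(** Take for [q] the least count: balance leaves only the counts [q] and [q + 1], and [excess s]
    lists once each label with the larger one. *)
Lemma count_excess (s : seq label) : balanced s ->
  exists q, forall a, count_mem a s = q + count_mem a (excess s).
Proof.
move=> /balancedP bal.
case: (@arg_minnP _ zero_label xpredT (fun a => count_mem a s)) => // b _ min_b.
exists (count_mem b s) => a; rewrite (@count_uniq_mem _ (excess s)) ?filter_uniq //.
case: mem_excess => [[c lt_ca] | no_less]; apply: anti_leq.
  by rewrite /= addn1 bal (leq_ltn_trans (min_b c isT) lt_ca).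
rewrite /= addn0 min_b // andbT leqNgt; apply/negP => lt_ba.
by apply: no_less; exists b.
Qed.

(** This is what makes the state space finite: for any continuation, a balanced word may be replaced
    by its excess. *)
Lemma excess_cat (s t : seq label) : balanced s ->
  balanced (s ++ t) = balanced (excess s ++ t) /\
  excess (s ++ t) = excess (excess s ++ t).
Proof.
move=> /count_excess[q count_s]; apply: (@eq_balanced_excess q) => a.
by rewrite !count_cat count_s addnA.
Qed.

Lemma sum_label_cat (s t : seq label) :
  sum_label (s ++ t) = add_label (sum_label s) (sum_label t).
Proof.
elim: s => [|a s IHs] /=; first by case: (sum_label t).
by rewrite IHs /add_label /= !addbA.
Qed.

Lemma sum_label_blocks (n : nat) : sum_label (flatten (nseq n labels)) = zero_label.
Proof. by elim: n => //= n ->. Qed.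

Lemma count_blocks (n : nat) (a : label) : count_mem a (flatten (nseq n labels)) = n.
Proof. by elim: n => //= n ->; case: a => [[] []]. Qed.

Lemma size_blocks (n : nat) : size (flatten (nseq n labels)) = 4 * n.
Proof. by elim: n => //= n ->; rewrite mulnS. Qed.

(** * States, transitions and the closed family *)

Notation state := (seq label * seq label * label)%type.

(* The first label is that of the next joint; the order of the others is irrelevant, so
   they are taken sorted to shorten the search. *)
Definition words (k : nat) : seq (seq label) :=
  [seq l <- iter k (fun W => [seq a :: l | a <- labels, l <- W]) [:: [::]] |
   sorted (fun a b => index a labels <= index b labels) (behead l)].

Lemma size_words (k : nat) (l : seq label) : l \in words k -> size l = k.
Proof.
rewrite mem_filter => /andP[_]; elim: k l => [|k IHk] l.
  by rewrite inE => /eqP->.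
by rewrite iterS => /allpairsPdep [a [t [_ /IHk <- ->]]].
Qed.

(* The state [(V, E, w)]: excess vertex labels, excess edge labels, label of the joint. *)
Definition successors (k : nat) (x : state) : seq state :=
  let: (V, E, w) := x in
  let extend l := rcons E (add_label w (sum_label l)) in
  [seq (excess (V ++ l), excess (extend l), head zero_label l) |
     l <- words k & balanced (V ++ l) && balanced (extend l)].

(* Found by the subset construction from the state of a single vertex labelled [o],
   followed by greedy deletion of states that are not needed for closedness. *)
Definition family : seq (seq state) :=
  let o := (false, false) in let x := (false, true) in
  let y := (true, false) in let z := (true, true) in
  [::
   [:: ([:: o], [::], o)];
   [:: ([:: o; x; y], [:: z], x);
       ([:: o; x; z], [:: y], z);
       ([:: o; y; z], [:: x], y)];
   [:: ([::], [:: o], x);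
       ([::], [:: o], y)];
   [:: ([:: o], [:: o], x);
       ([:: y], [:: y], x)];
   [:: ([:: x; y], [:: z], x);
       ([:: x; z], [:: y], x)];
   [:: ([:: o], [:: y; z], o);
       ([:: o], [:: y; z], z)];
   [:: ([:: o; z], [:: x; z], z);
       ([:: x; z], [:: y; z], x);
       ([:: x; z], [:: y; z], y);
       ([:: y; z], [:: o; y], y)];
   [:: ([:: o; x; z], [:: o; z], z);
       ([:: o; x; z], [:: y; z], y);
       ([:: o; y; z], [:: x; y], o)];
   [:: ([::], [:: y; z], o);
       ([::], [:: y; z], z)];
   [:: ([:: o; z], [:: o; y], o);
       ([:: x; z], [:: o; z], z)];
   [:: ([:: o; x; y], [:: o; y], o);
       ([:: o; x; z], [:: o; z], z)];
   [:: ([::], [:: o; y], o);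
       ([::], [:: o; y], z)];
   [:: ([:: x], [:: o; z], o);
       ([:: y], [:: o; z], z);
       ([:: z], [:: o; y], o)];
   [:: ([:: o; x; y], [:: o; y; z], x);
       ([:: o; x; y], [:: o; y; z], y)];
   [:: ([::], [:: o; y; z], x);
       ([::], [:: o; y; z], y)];
   [:: ([:: y], [:: x; y; z], x);
       ([:: z], [:: o; y; z], y)];
   [:: ([:: x; y], [:: o; y; z], x);
       ([:: x; y], [:: o; y; z], y)];
   [:: ([:: y], [:: o; x; y], y);
       ([:: z], [:: o; y; z], y)];
   [:: ([:: o; z], [::], z)];
   [:: ([:: o; x; y], [::], o);
       ([:: o; x; y], [::], x);
       ([:: x; y; z], [::], x)];
   [:: ([::], [::], o)];
   [:: ([:: o], [:: y], z);
       ([:: x], [:: o], o);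
       ([:: z], [:: y], o)];
   [:: ([:: o; x], [:: z], z);
       ([:: y; z], [:: y], y)];
   [:: ([:: o; x; y], [:: y], o);
       ([:: o; y; z], [:: o], o)];
   [:: ([::], [:: y], z);
       ([::], [:: z], y)]].

Definition closed_family (fam : seq (seq state)) : bool :=
  all (fun X => (X != [::]) && all (fun k =>
    let Y := flatten [seq successors k x | x <- X] in
    has (all (mem Y)) fam) [:: 2; 3; 4; 5]) fam.

Lemma family_closed : closed_family family.
Proof. by vm_compute. Qed.

(** * Label words for arbitrary edge sizes *)

Definition new_labels (f : nat -> seq label) (m : nat) : seq label :=
  flatten (mkseq f m.+1).

Definition edge_label (f : nat -> seq label) (i : nat) : label :=
  add_label (head zero_label (f i)) (sum_label (f i.+1)).

(** The word [f 0] labels a starting vertex, which acts as the joint of the first edge; [f i.+1]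
    labels the [k i] new vertices of edge [i], the joint with the next edge first. *)
Definition realizes (k : nat -> nat) (m : nat) (f : nat -> seq label) (x : state) : Prop :=
  [/\ f 0 = [:: zero_label],
      forall i, i < m -> size (f i.+1) = k i,
      balanced (new_labels f m),
      balanced (mkseq (edge_label f) m) &
      x = (excess (new_labels f m), excess (mkseq (edge_label f) m),
           head zero_label (f m))].

Lemma eq_mkseq_lt (A : Type) (f g : nat -> A) (n : nat) :
  (forall i, i < n -> f i = g i) -> mkseq f n = mkseq g n.
Proof.
by move=> fg; apply/eq_in_map => i; rewrite mem_iota => /andP[_ /fg].
Qed.

(** The [4 * q] surplus vertices receive [q] copies of all four labels, which sum to zero and shift
    all counts equally. They come after [l], nonempty since [0 < r], so the joint keeps its
    label. *)
Lemma realizes_successor (k : nat -> nat) (m r q : nat) (f : nat -> seq label)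
    (x y : state) : 0 < r -> k m = r + 4 * q -> realizes k m f x -> y \in successors r x ->
  exists g, realizes k m.+1 g y.
Proof.
move=> r_gt0 km [f0 size_f balV balE ->] /mapP[l].
rewrite mem_filter => /andP[/andP[balVl balEl] l_r] ->.
have size_l := size_words l_r.
pose g i := if i == m.+1 then l ++ flatten (nseq q labels) else f i.
have gm : g m.+1 = l ++ flatten (nseq q labels) by rewrite /g eqxx.
have gf i : i <= m -> g i = f i by rewrite /g; case: eqP => // -> /[!ltnn].
have head_g : head zero_label (g m.+1) = head zero_label l.
  by rewrite gm; case: (l) size_l r_gt0 => //= <-.
have new_g : new_labels g m.+1 = new_labels f m ++ g m.+1.
  rewrite /new_labels mkseqS flatten_rcons; congr (flatten _ ++ _).
  by apply: eq_mkseq_lt => i; rewrite ltnS => /gf.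
have edge_gm : edge_label g m = add_label (head zero_label (f m)) (sum_label l).
  rewrite /edge_label gm gf // sum_label_cat sum_label_blocks.
  by case: (sum_label l) => [[] []].
have edges_g : mkseq (edge_label g) m.+1 =
    rcons (mkseq (edge_label f) m) (edge_label g m).
  rewrite mkseqS; congr rcons; apply: eq_mkseq_lt => i lt_im.
  by rewrite /edge_label !gf // ltnW.
have [balV' exV'] := excess_cat (g m.+1) balV.
have [balE' exE'] := excess_cat [:: edge_label g m] balE.
set V := excess (new_labels f m) in balVl balV' exV' *.
have [balg exg] : balanced (V ++ g m.+1) = balanced (V ++ l) /\
    excess (V ++ g m.+1) = excess (V ++ l).
  apply: (@eq_balanced_excess q) => a.
  by rewrite gm !count_cat count_blocks addnA addnC.
exists g; split.
- by rewrite gf.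
- move=> i; rewrite ltnS leq_eqVlt => /predU1P[-> | lt_im].
    by rewrite gm size_cat size_l size_blocks km.
  by rewrite gf ?size_f.
- by rewrite new_g balV' balg.
- by rewrite edges_g -cats1 balE' cats1 edge_gm.
- by rewrite new_g exV' exg edges_g -(cats1 (mkseq _ _)) exE' cats1 edge_gm head_g.
Qed.

(** The induction keeps all states of [X] realizable, each by its own [f], because the sizes still
    to come decide which of them is needed. *)
Lemma family_realizable (k : nat -> nat) (m : nat) :
    (forall i, i < m -> 1 < k i) ->
  exists2 X, X \in family & forall x, x \in X -> exists f, realizes k m f x.
Proof.
elim: m => [|m IHm] k_gt1.
  exists [:: ([:: zero_label], [::], zero_label)]; first exact: mem_head.
  move=> x; rewrite inE => /eqP->; exists (fun=> [:: zero_label]).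
  by split; rewrite // /new_labels /mkseq.
have [i lt_im | X X_fam realX] := IHm; first by apply: k_gt1; rewrite ltnS ltnW.
(* The representative of [k m] modulo 4 among 2, 3, 4, 5. *)
pose r := ((k m - 2) %% 4).+2.
have km : k m = r + 4 * ((k m - 2) %/ 4).
  rewrite -[in LHS](subnK (k_gt1 m _)) // [in LHS](divn_eq (k m - 2) 4).
  by rewrite /r addn2 addSn addSn addnC mulnC.
have r_in : r \in [:: 2; 3; 4; 5].
  by rewrite /r; have := ltn_pmod (k m - 2) (isT : 0 < 4); case: (_ %% 4) => [|[|[|[|]]]].
have /andP[_ /allP/(_ r r_in)/hasP[Y Y_fam /allP YX]] := allP family_closed X X_fam.
exists Y => // y /YX/flatten_mapP[x /realX[f fx] yx].
exact: realizes_successor km fx yx.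
Qed.

Lemma balanced_words (k : nat -> nat) (m : nat) :
    (forall i, i < m -> 1 < k i) ->
  exists f, [/\ f 0 = [:: zero_label],
      forall i, i < m -> size (f i.+1) = k i,
      balanced (new_labels f m) & balanced (mkseq (edge_label f) m)].
Proof.
move=> /family_realizable[X X_fam realX].
have /andP[] := allP family_closed X X_fam.
case: X X_fam realX => // x X _ realX _ _.
by have [f [? ? ? ? _]] := realX x (mem_head _ _); exists f.
Qed.

(** * Transfer to the group *)

Definition group_label (a : label) : Agrp := ((a.1 : nat)%:R%R, (a.2 : nat)%:R%R).

Lemma group_label_inj : injective group_label.
Proof. by case=> [[] []] [[] []] => // /eqP. Qed.

Lemma group_label_surj (a : Agrp) : exists b, group_label b = a.
Proof.
case: a => [[[|[|//]] lt_i] [[|[|//]] lt_j]].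
- by exists (false, false); congr (_, _); apply: val_inj.
- by exists (false, true); congr (_, _); apply: val_inj.
- by exists (true, false); congr (_, _); apply: val_inj.
by exists (true, true); congr (_, _); apply: val_inj.
Qed.

Lemma group_labelD (a b : label) :
  group_label (add_label a b) = (group_label a + group_label b)%R.
Proof. by case: a b => [[] []] [[] []]; congr (_, _); apply: val_inj. Qed.

Lemma group_label_sum (s : seq label) :
  group_label (sum_label s) = (\sum_(a <- [seq group_label b | b <- s]) a)%R.
Proof.
elim: s => [|a s IHs]; first by rewrite big_nil; congr (_, _); apply: val_inj.
by rewrite /= big_cons group_labelD IHs.
Qed.

Lemma count_group_label (a : label) (s : seq label) :
  count_mem (group_label a) [seq group_label b | b <- s] = count_mem a s.
Proof.
by rewrite count_map; apply: eq_count => b /=; rewrite (inj_eq group_label_inj).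
Qed.

(** * Splitting the vertices into blocks *)

(* The vertices of [E j] outside its predecessor, the joint with [E j.+1] first. The
   sequence starts with an artificial edge [E 0], a singleton contained in [E 1], so that
   [E 1] is treated like the other edges ([0.-1 = 0] is harmless). *)
Definition block (T : finType) (E : nat -> {set T}) (j : nat) : seq T :=
  enum (E j :&: E j.+1) ++ enum (E j :\: E j.-1 :\: E j.+1).

Section Blocks.

Variables (T : finType) (m : nat) (E : nat -> {set T}).
Hypothesis far_disjoint : forall i j, i.+2 <= j -> E i :&: E j = set0.
Hypothesis start_sub : E 0 \subset E 1.

Lemma not_mem_far (v : T) (i j : nat) : i.+2 <= j -> v \in E i -> v \notin E j.
Proof.
move=> lt_ij vi; apply/negP => vj.
by have := in_set0 v; rewrite -(far_disjoint lt_ij) inE vi vj.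
Qed.

Lemma mem_block0 (v : T) : (v \in block E 0) = (v \in E 0).
Proof.
rewrite mem_cat !mem_enum !inE; have /implyP := subsetP start_sub v.
by case: (v \in E 0); case: (v \in E 1).
Qed.

Lemma mem_blockS (j : nat) (v : T) :
  (v \in block E j.+1) = (v \in E j.+1) && (v \notin E j).
Proof.
rewrite mem_cat !mem_enum !inE /=.
case vj: (v \in E j); last by case: (v \in E j.+1); case: (v \in E j.+2).
by rewrite (negbTE (not_mem_far (leqnn _) vj)) !andbF.
Qed.

Lemma block_sub (j : nat) (v : T) : v \in block E j -> v \in E j.
Proof. by case: j => [|j]; rewrite ?mem_block0 // mem_blockS => /andP[]. Qed.

Lemma uniq_block (j : nat) : uniq (block E j).
Proof.
rewrite cat_uniq !enum_uniq andbT; apply/hasPn => v.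
by rewrite !mem_enum !inE => /andP[/negbTE->]; rewrite andbF.
Qed.

Lemma uniq_blocks (n : nat) : uniq (flatten (mkseq (block E) n)).
Proof.
elim: n => // n IHn; rewrite mkseqS flatten_rcons cat_uniq IHn uniq_block andbT /=.
apply/hasPn => v vn; apply/negP => /flatten_mapP[i].
rewrite mem_iota /= add0n => lt_in /block_sub vi.
case: n lt_in vn {IHn} => // n; rewrite ltnS leq_eqVlt mem_blockS.
case/predU1P => [<- | lt_in] /andP[vn]; first by rewrite vi.
by have := not_mem_far (_ : i.+2 <= n.+1) vi; rewrite vn => /(_ lt_in).
Qed.

Lemma mem_blocks (n j : nat) (v : T) :
  j < n -> v \in E j -> v \in flatten (mkseq (block E) n).
Proof.
move=> lt_jn vj; have ex_i : exists i, v \in E i by exists j.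
(* A vertex is listed in the block of the first edge containing it. *)
case: (ex_minnP ex_i) => i vi min_i; apply/flatten_mapP; exists i.
  by rewrite mem_iota /= add0n (leq_ltn_trans (min_i j vj)).
case: i vi min_i => [|i] vi min_i; rewrite ?mem_block0 // mem_blockS vi /=.
by apply/negP => /min_i; rewrite ltnn.
Qed.

(** Splits the sum over an edge into joint and new vertices, as in [edge_label]. *)
Lemma perm_block (j : nat) (w : T) :
  E j :&: E j.+1 = [set w] -> perm_eq (w :: block E j.+1) (enum (E j.+1)).
Proof.
move=> Ew; have /setIP[wj wj1] : w \in E j :&: E j.+1 by rewrite Ew set11.
apply: uniq_perm; rewrite ?enum_uniq //= ?uniq_block ?mem_blockS ?wj ?andbF //.
move=> v; rewrite inE mem_blockS mem_enum.
have := in_set1 v w; rewrite -Ew inE => <-.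
by case: (v \in E j); case: (v \in E j.+1).
Qed.

Lemma head_block (j : nat) (w : T) (A : Type) (c : T -> A) (a : A) :
  E j :&: E j.+1 = [set w] -> head a [seq c v | v <- block E j] = c w.
Proof. by rewrite /block => ->; rewrite enum_set1. Qed.

End Blocks.

(** * From label words to labellings of hyperpaths *)

Lemma path_labelling (T : finType) (m : nat) (E : nat -> {set T}) (v0 : T) :
    E 0 = [set v0] -> E 0 \subset E 1 ->
    (forall i j, i.+2 <= j -> E i :&: E j = set0) ->
    (forall j, j < m -> #|E j :&: E j.+1| = 1) ->
    (forall j, j < m -> 3 <= #|E j.+1|) ->
    (forall v, exists2 j, j <= m & v \in E j) ->
  exists c : T -> Agrp, A_friendly c /\
    forall a b, count_mem a (mkseq (fun j => induced c (E j.+1)) m)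
             <= count_mem b (mkseq (fun j => induced c (E j.+1)) m) + 1.
Proof.
move=> E0 E01 Efar Enear Ebig Ecover.
have [j lt_jm | f [f0 size_f balV balE]] := @balanced_words (fun j => #|E j.+1|.-1) m.
  by have := Ebig j lt_jm; case: #|_|.
pose vs := flatten (mkseq (block E) m.+1).
(* Vertices and labels are matched by position; since the blocks have the lengths of the words
   [f j], this matches them block by block. *)
pose c v := group_label (nth zero_label (new_labels f m) (index v vs)).
have uniq_vs : uniq vs by exact: uniq_blocks.
have size_block j : j < m.+1 -> size (block E j) = size (f j).
  case: j => [_ | j lt_jm].
    by rewrite f0 /block setDv set0D enum_set0 cats0 (setIidPl E01) E0 enum_set1.
  have /eqP/cards1P[w Ew] := Enear j lt_jm.
  by rewrite size_f // cardE -(perm_size (perm_block Efar Ew)).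
have shapes : shape (mkseq (block E) m.+1) = shape (mkseq f m.+1).
  rewrite /shape -!map_comp.
  by apply: (@eq_mkseq_lt _ (size \o block E) (size \o f) m.+1) => j /size_block.
have map_vs : [seq c v | v <- vs] = [seq group_label a | a <- new_labels f m].
  have size_vs : size vs = size (new_labels f m) by rewrite !size_flatten shapes.
  apply: (@eq_from_nth _ (group_label zero_label)); rewrite !size_map // => i lt_i.
  by rewrite (nth_map v0) // (nth_map zero_label) -?size_vs // /c index_uniq.
have map_block j : j <= m -> [seq c v | v <- block E j] = [seq group_label a | a <- f j].
  move=> le_jm.
  have : [seq [seq c v | v <- s] | s <- mkseq (block E) m.+1] =
         [seq [seq group_label a | a <- s] | s <- mkseq f m.+1].
    apply: eq_from_flatten_shape; first by rewrite -!map_flatten.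
    move: shapes; rewrite /shape -!map_comp => /eq_in_map shapes.
    by apply/eq_in_map => i /shapes /=; rewrite !size_map.
  by rewrite -!map_comp => /eq_in_map; apply; rewrite mem_iota.
have edge_c j : j < m -> induced c (E j.+1) = group_label (edge_label f j).
  move=> lt_jm; have /eqP/cards1P[w Ew] := Enear j lt_jm.
  rewrite /induced -big_enum -(perm_big _ (perm_block Efar Ew)) big_cons.
  rewrite group_labelD group_label_sum -map_block // big_map; congr (_ + _)%R.
  rewrite -(head_block c (c w) Ew) map_block 1?ltnW //.
  (* The two heads have different defaults, so [f j] must be nonempty: it is as long as [block E j],
     which contains [w]. *)
  have := size_block j (leqW lt_jm).
  by case: (f j) => // /size0nil; rewrite /block Ew enum_set1.
have vcount_c a : vcount c (group_label a) = count_mem a (new_labels f m).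
  rewrite -count_group_label -map_vs count_map -size_filter /vcount cardE.
  apply/perm_size/uniq_perm; rewrite ?enum_uniq ?filter_uniq // => v.
  rewrite mem_enum inE mem_filter /=.
  by have [j le_jm vj] := Ecover v; rewrite (mem_blocks Efar E01 _ vj) ?andbT.
have ecount_c : mkseq (fun j => induced c (E j.+1)) m =
    [seq group_label a | a <- mkseq (edge_label f) m].
  rewrite -map_comp.
  by apply: (@eq_mkseq_lt _ _ (group_label \o edge_label f) m) => j /edge_c.
exists c; split=> a b.
  have [[a' <-] [b' <-]] := (group_label_surj a, group_label_surj b).
  by rewrite !vcount_c addn1; apply/balancedP.
have [[a' <-] [b' <-]] := (group_label_surj a, group_label_surj b).
by rewrite ecount_c !count_group_label addn1; apply/balancedP.
Qed.

(** Edges with different indices share at most one vertex, but each has at least three. Hence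
    counting edges as sets agrees with counting indices. *)
Lemma hyperpath_inj (T : finType) (m : nat) (e : 'I_m -> {set T}) :
  hyperpath e -> injective e.
Proof.
case=> [[_ _ near far] big] i j.
wlog lt_ij : i j / val i < val j => [IH eij | eij].
  case: (ltngtP (val i) (val j)) => [/IH/(_ eij) // | /IH/(_ (esym eij)) // | /val_inj //].
have := big i; have [/(far i j) | ] := boolP ((val i).+2 <= val j).
  by rewrite eij setIid => ->; rewrite cards0.
rewrite -ltnNge ltnS => le_ji.
have /(near i j) : val j = (val i).+1 by apply/eqP; rewrite eqn_leq le_ji.
by rewrite eij setIid => ->.
Qed.

Lemma ecount_edge_set (T : finType) (m : nat) (e : 'I_m -> {set T}) (c : T -> Agrp)
    (a : Agrp) : injective e ->
  ecount (edge_set e) c a = #|[set i | induced c (e i) == a]|.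
Proof.
move=> inj_e; rewrite /ecount -(card_imset _ inj_e); congr #|pred_of_set _|.
apply/setP => s; rewrite inE; apply/andP/imsetP => [[/imsetP[i _ ->] eq_a] | [i]].
  by exists i; rewrite ?inE.
by rewrite inE => eq_a ->; rewrite imset_f.
Qed.

Theorem theorem8 (T : finType) (m : nat) (e : 'I_m -> {set T}) :
  hyperpath e -> A_cordial (edge_set e).
Proof.
move=> path_e; have inj_e := hyperpath_inj path_e.
have [[m_gt0 cover near far] big] := path_e.
pose E' j := if insub j is Some i then e i else set0.
have E'e (i : 'I_m) : E' i = e i by rewrite /E' valK.
have E'0 j : m <= j -> E' j = set0 by move=> le_mj; rewrite /E' insubN // -leqNgt.
(* The artificial edge [[set v0]] must lie in the first edge and miss the second; the first has at
   least three vertices and shares at most one with the second. *)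
have [v0 v00 v01] : exists2 v, v \in E' 0 & v \notin E' 1.
  apply/subsetPn; apply/negP => /setIidPl E'01.
  have := big (Ordinal m_gt0); rewrite -E'e /= -E'01.
  case: (ltnP 1 m) => [m_gt1 | /E'0->]; last by rewrite setI0 cards0.
  by rewrite (E'e (Ordinal m_gt0)) (E'e (Ordinal m_gt1)) near.
have E'far i j : i.+2 <= j -> E' i :&: E' j = set0.
  move=> lt_ij; case: (ltnP j m) => [lt_jm | /E'0->]; last by rewrite setI0.
  have lt_im : i < m by apply: leq_trans lt_jm; rewrite ltnS ltnW // ltnW.
  by rewrite (E'e (Ordinal lt_im)) (E'e (Ordinal lt_jm)) far.
pose E j := if j is i.+1 then E' i else [set v0].
have E01 : E 0 :&: E 1 = [set v0] by apply/setIidPl; rewrite sub1set.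
have [] := @path_labelling T m E v0.
- by [].
- by rewrite sub1set.
- case=> [|i] [|[|j]] // lt_ij; last exact: (E'far i j.+1).
  apply/setP => v; rewrite !inE; case: eqP => //= ->; apply/negP => v0j.
  case: j lt_ij v0j => [|j] _ v0j; first by rewrite v0j in v01.
  by have := in_set0 v0; rewrite -(E'far 0 j.+2) // inE v00 v0j.
- case=> [|j] lt_jm; first by rewrite E01 cards1.
  by rewrite /= (E'e (Ordinal (ltnW lt_jm))) (E'e (Ordinal lt_jm)) near.
- by move=> j lt_jm; rewrite /= (E'e (Ordinal lt_jm)).
- move=> v; have : v \in [set: T] by rewrite inE.
  by rewrite -cover => /bigcupP[i _ vi]; exists i.+1 => //=; rewrite E'e.
move=> c [friendly_c bal_c]; exists c; split=> // a b.
suff count_e d : ecount (edge_set e) c d =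
    count_mem d (mkseq (fun j => induced c (E j.+1)) m).
  by rewrite !count_e.
rewrite ecount_edge_set // /mkseq -val_enum_ord -map_comp count_map cardE.
rewrite -(size_filter _ (enum 'I_m)).
apply/perm_size/uniq_perm; rewrite ?enum_uniq ?(filter_uniq _ (enum_uniq _)) // => i.
by rewrite mem_enum inE mem_filter mem_enum andbT /= E'e.
Qed.
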